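(* Let $v\in\mathbb{N}\setminus\{1\}$ and let $h\colon\mathbb{N}_2\to\mathbb{C}$ be a $v$-transitive light weight such that $v\in V(h)$. Suppose that $D_h(1)_2$ and $B_{h,v}(1)_2$ exist, and that $c=\sum_{n\ge1}|b_n^h|<1$. If $B_{h,v}(x)=B_h(x)$ then $A_{h,v}(x)=0$. If $B_{h,v}(x)\ne B_h(x)$, let $k\in\mathbb{N}_0$ be minimum such that $b_k^{h,v}\ne b_k^h$; if $$\big(|b_k^{h,v}-b_k^h|\cdot(1-c)\big)^{-1}\sum_{n>k}|b_n^{h,v}-b_n^h|<1,$$ then $B_h(1)_2$ exists, $B_h(1)_2\ne0$, $A_{h,v}(1)_2$ exists and $$A_{h,v}(1)_2\in D_h(1)_2\cdot\mathrm{sqrt}\Big(1-\frac{B_{h,v}(1)_2}{B_h(1)_2}\Big).$$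
   Context: $\mathbb{N}=\{1,2,\dots\}$, $\mathbb{N}_0=\{0,1,2,\dots\}$, and $\mathbb{N}_2=\{e\subset\mathbb{N}:|e|=2\}$. A weight is a map $h\colon\mathbb{N}_2\to\mathbb{C}$. A walk of length $n\in\mathbb{N}_0$ is a tuple $w=\langle v_0,\dots,v_n\rangle$ of elements of $\mathbb{N}$ with $v_{i-1}\ne v_i$ for $i=1,\dots,n$; its weight is $h(w)=\prod_{i=1}^n h(\{v_{i-1},v_i\})$ (and $h(w)=1$ if $n=0$). A series $\sum_{x\in X}g(x)$ over an at most countable set $X$ converges absolutely if the sums $\sum_{x\in Y}|g(x)|$ over finite $Y\subset X$ are bounded. For a set $W$ of walks, $h(W)$ denotes the sum of $\sum_{w\in W}h(w)$ when it converges absolutely. $W(n)$ is the set of walks of length $n$ with $v_0=1$. The weight $h$ is light if $\sum_{w\in W(n)}h(w)$ converges absolutely for every $n\in\mathbb{N}_0$. $V(h)$ is the set of vertices $u\in\mathbb{N}$ such that some walk starting at $1$ and ending at $u$ has nonzero weight. For $v\in\mathbb{N}\setminus\{1\}$, $h$ is $v$-transitive if there is a bijection $f\colon\mathbb{N}\to\mathbb{N}$ with $f(1)=v$ and $h(\{f(a),f(b)\})=h(\{a,b\})$ for all $\{a,b\}\in\mathbb{N}_2$. Define formal power series in $\mathbb{C}[[x]]$: $A_{h,v}(x)=\sum_n h(W(v,n))x^n$, where $W(v,n)$ is the set of walks in $W(n)$ visiting $v$; $B_h(x)=\sum_n b_n^hx^n$, $b_n^h$ the weight of walks of length $n$ with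 $v_0=v_n=1$; $B_{h,v}(x)=\sum_n b_n^{h,v}x^n$, $b_n^{h,v}$ the weight of walks of length $n$ with $v_0=v_n=1$ and $v_i\ne v$ for all $i$; $D_h(x)=\sum_nh(W(n))x^n$. For $U(x)=\sum_{n\ge0}u_nx^n\in\mathbb{C}[[x]]$, we say $U(1)_2$ exists if $\sum_{n\ge0}|u_n|<\infty$, and then $U(1)_2=\sum_{n\ge0}u_n$. For $w,z\in\mathbb{C}$, $w\cdot\mathrm{sqrt}(z)=\{w\alpha:\alpha\in\mathbb{C},\ \alpha^2=z\}$. *)

(* Defs.v *)
(* The complex numbers are [R[i]] for an arbitrary [R : realType]. *)
From mathcomp Require Export all_boot all_order all_algebra finmap.
From mathcomp Require Export all_classical all_reals all_analysis complex.
From mathcomp Require summability.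

Set Implicit Arguments.
Unset Strict Implicit.
Unset Printing Implicit Defensive.

Import Order.TTheory GRing.Theory Num.Theory.
Export numFieldNormedType.Exports.

#[export] Set Implicit Arguments.
#[export] Unset Strict Implicit.
#[export] Unset Printing Implicit Defensive.

Local Open Scope classical_set_scope.
Local Open Scope ring_scope.

(* The modulus as an element of [R]; on [R[i]] the generic norm [`|z|] is
   complex-valued. *)
Notation cabs := (@ComplexField.Normc.normc _).

Definition abs_summable (R : realType) (T : choiceType) (X : set T)
    (g : T -> R[i]) : Prop :=
  summable X (fun x => (cabs (g x))%:E).

(* Unordered sum over [X]: the limit of the sums of [g] over the finite subsets
   of [X], directed by inclusion. Meaningful when [abs_summable X g] holds.
   [R[i]^o] gives the complex numbers their usual topology. *)
Definition csum (R : realType) (T : choiceType) (X : set T)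
    (g : T -> R[i]) : R[i] :=
  @summability.sum T R[i] R[i]^o (fun x => if x \in X then g x else 0).

(* Formal power series over the complex numbers, as coefficient sequences. *)
Definition powser (R : realType) := nat -> R[i].

Definition exists_at1 (R : realType) (U : powser R) : Prop :=
  (\sum_(0 <= n <oo) (cabs (U n))%:E < +oo)%E.

(* Meaningful when [exists_at1 U] holds. *)
Definition value_at1 (R : realType) (U : powser R) : R[i] :=
  limn (series (U : nat -> R[i]^o)).

Definition mul_sqrt (R : realType) (w z : R[i]) : set R[i] :=
  [set w * a | a in [set a | a ^+ 2 = z]].

(* The vertex set is {1, 2, ...}. *)
Definition vertex := {n : nat | (0 < n)%N}.
Definition vertex1 : vertex := exist _ 1%N isT.

Definition edge := {e : {fset vertex} | #|` e| == 2%N}.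

Definition weight (R : realType) := edge -> R[i].

(* h({a, b}); the value 0 for a = b is a dummy, since consecutive vertices of
   a walk differ. *)
Definition edge_weight (R : realType) (h : weight R) (a b : vertex) : R[i] :=
  oapp h 0 (insub [fset a; b]%fset).

(* The walk <v_0, ..., v_n> is the sequence [:: v_0; ...; v_n], of size n.+1. *)
Definition is_walk (w : seq vertex) : bool :=
  (0 < size w)%N && sorted [rel a b | a != b] w.

Definition walk_weight (R : realType) (h : weight R) (w : seq vertex) : R[i] :=
  \prod_(1 <= i < size w) edge_weight h (nth vertex1 w i.-1) (nth vertex1 w i).

Definition set_weight (R : realType) (h : weight R) (W : set (seq vertex)) :
  R[i] := csum W (walk_weight h).

Definition walks (n : nat) : set (seq vertex) :=
  [set w | [/\ is_walk w, size w = n.+1 & head vertex1 w = vertex1]].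

Definition walks_visiting (v : vertex) (n : nat) : set (seq vertex) :=
  [set w | walks n w /\ v \in w].

Definition closed_walks (n : nat) : set (seq vertex) :=
  [set w | walks n w /\ last vertex1 w = vertex1].

Definition closed_walks_avoiding (v : vertex) (n : nat) : set (seq vertex) :=
  [set w | closed_walks n w /\ v \notin w].

Definition light (R : realType) (h : weight R) : Prop :=
  forall n, abs_summable (walks n) (walk_weight h).

Definition reachable (R : realType) (h : weight R) : set vertex :=
  [set u | exists w, [/\ is_walk w, head vertex1 w = vertex1,
                         last vertex1 w = u & walk_weight h w != 0]].

Definition v_transitive (R : realType) (v : vertex) (h : weight R) : Prop :=
  exists f : vertex -> vertex,
    [/\ bijective f, f vertex1 = v
      & forall a b, a != b -> edge_weight h (f a) (f b) = edge_weight h a b].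

Definition A_ser (R : realType) (h : weight R) (v : vertex) : powser R :=
  fun n => set_weight h (walks_visiting v n).

Definition B_ser (R : realType) (h : weight R) : powser R :=
  fun n => set_weight h (closed_walks n).

Definition Bv_ser (R : realType) (h : weight R) (v : vertex) : powser R :=
  fun n => set_weight h (closed_walks_avoiding v n).

Definition D_ser (R : realType) (h : weight R) : powser R :=
  fun n => set_weight h (walks n).

(* Main.v *)
Require Import Defs.
From mathcomp Require Import ring lra zify.

(* Let H be the generating function of the walks from 1 that visit v exactly
   once, at their end. Splitting walks at their first visit of v gives
   A = H D and B = B_v + H G, where G counts walks from v to 1; reversing these
   and splitting again gives G = H B, since v-transitivity lets walks from v be
   counted as walks from 1. Hence B - B_v = H^2 B, and everything except the
   absolute convergence of H(1) is formal.
   For that, let m be the order of H; then k = 2m. Dividing by lowest terms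
   gives S^2 B = 1 + g, where S is the normalised H and g has l1-norm < 1 - c.
   Power series with constant term 1 whose other coefficients have l1-norm at
   most 1 have absolutely summable square roots, so S Q = sqrt(1 + g) and
   Q = sqrt(B) are summable, and c < 1 allows dividing (S Q) Q = S B by B. *)

Import Order.TTheory GRing.Theory Num.Theory.

Local Open Scope classical_set_scope.
Local Open Scope ring_scope.

(** * Cauchy products *)

Definition conv (K : pzSemiRingType) (u v : nat -> K) (n : nat) : K :=
  \sum_(i < n.+1) u i * v (n - i)%N.

Section CauchyProduct.
Variable K : comNzRingType.
Implicit Types u v w : nat -> K.

(** Coefficients up to [m] do not see the truncation to polynomials, so the ring laws of polynomials
    carry over to Cauchy products. *)
Lemma convE m u v n : (n <= m)%N ->
  conv u v n = ((\poly_(i < m.+1) u i) * (\poly_(i < m.+1) v i))`_n.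
Proof.
move=> nm; rewrite coefM; apply: eq_bigr => i _.
by rewrite !coef_poly !ltnS (leq_trans (leq_ord i)) ?(leq_trans (leq_subr _ _)).
Qed.

Lemma convC u v : conv u v = conv v u.
Proof. by apply/funext => n; rewrite !(@convE n) // mulrC. Qed.

Lemma convA u v w : conv u (conv v w) = conv (conv u v) w.
Proof.
have convAn n : conv (conv u v) w n =
    (\poly_(i < n.+1) u i * \poly_(i < n.+1) v i * \poly_(i < n.+1) w i)`_n.
  rewrite coefM; apply: eq_bigr => i _; rewrite (@convE n) ?leq_ord //.
  by rewrite coef_poly ltnS leq_subr.
apply/funext => n; rewrite convAn convC.
have -> : conv (conv v w) u n =
    (\poly_(i < n.+1) v i * \poly_(i < n.+1) w i * \poly_(i < n.+1) u i)`_n.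
  rewrite coefM; apply: eq_bigr => i _; rewrite (@convE n) ?leq_ord //.
  by rewrite coef_poly ltnS leq_subr.
by rewrite mulrC mulrA.
Qed.

Lemma conv_recl u v n :
  conv u v n = u 0%N * v n + \sum_(i < n) u i.+1 * v (n - i.+1)%N.
Proof. by rewrite /conv big_ord_recl subn0. Qed.

Lemma conv0E u v : conv u v 0%N = u 0%N * v 0%N.
Proof. by rewrite conv_recl big_ord0 addr0. Qed.

Lemma conv_shiftl m u v n : (forall i, (i < m)%N -> u i = 0) ->
  conv u v (n + m)%N = conv (fun i => u (i + m)%N) v n.
Proof.
move=> u0; rewrite /conv -!(big_mkord predT (fun i => u i * v (n + m - i)%N)).
rewrite (big_cat_nat (leq0n m)) ?(leq_trans (leq_addl n m)) //=.
rewrite big_nat big1 ?add0r => [|i /andP[_ im]]; last by rewrite u0 ?mul0r.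
rewrite -{1}[m]add0n big_addn -addSn addnK big_mkord.
by apply: eq_bigr => i _; rewrite subnDr.
Qed.

Lemma conv_lt m u v n : (forall i, (i < m)%N -> u i = 0) -> (n < m)%N ->
  conv u v n = 0.
Proof.
move=> u0 nm; apply: big1 => i _; rewrite u0 ?mul0r //.
by rewrite (leq_ltn_trans _ nm) // -ltnS.
Qed.

(** Vanishing below [m] means divisibility by x^m; dividing u^2 v by x^(2m) divides each factor u by
    x^m. *)
Lemma conv_shift2 m u v n : (forall i, (i < m)%N -> u i = 0) ->
  conv u (conv u v) (n + m + m)%N =
  conv (fun i => u (i + m)%N) (conv (fun i => u (i + m)%N) v) n.
Proof.
move=> u0; rewrite conv_shiftl // convC conv_shiftl.
  by rewrite convC; congr conv; apply/funext => i; rewrite conv_shiftl.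
by move=> i im; exact: (conv_lt _ u0).
Qed.

Lemma conv2_lt m u v n : (forall i, (i < m)%N -> u i = 0) -> (n < m + m)%N ->
  conv u (conv u v) n = 0.
Proof.
move=> u0 nm; have [nm1|mn] := ltnP n m; first exact: (conv_lt _ u0).
rewrite -(subnK mn) conv_shiftl // convC; apply: (@conv_lt m).
  by move=> i im; exact: (conv_lt _ u0).
by rewrite ltn_subLR.
Qed.

Lemma convZl a u v n : conv (fun i => a * u i) v n = a * conv u v n.
Proof. by rewrite /conv mulr_sumr; apply: eq_bigr => i _; rewrite mulrA. Qed.

(** Both sides sum [u i * v j] over the triangle i + j < N. *)
Lemma sum_conv u v N :
  \sum_(n < N) conv u v n = \sum_(i < N) u i * \sum_(j < N - i) v j.
Proof.
elim: N => [|N IH]; first by rewrite !big_ord0.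
rewrite big_ord_recr /= IH.
have -> : \sum_(i < N) u i * \sum_(j < N - i) v j =
          \sum_(i < N.+1) u i * \sum_(j < N - i) v j.
  by rewrite big_ord_recr /= subnn big_ord0 mulr0 addr0.
rewrite -big_split /=; apply: eq_bigr => i _.
by rewrite subSn ?leq_ord // big_ord_recr mulrDr.
Qed.

End CauchyProduct.

(** * Square roots of formal power series *)

Section SquareRoot.
Variable K : numFieldType.
Implicit Types u v w : nat -> K.

(** The recursion solves the coefficient equation of u^2 = w for its new unknown, which occurs there
    as twice itself. It needs all earlier coefficients, hence a list. *)
Fixpoint sqrt_seq w n : seq K :=
  if n is n'.+1 then
    let s := sqrt_seq w n' in
    rcons s ((w n'.+1 - \sum_(i < n') s`_i.+1 * s`_(n' - i)) / 2)
  else [:: 1].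

Lemma size_sqrt_seq w n : size (sqrt_seq w n) = n.+1.
Proof. by elim: n => //= n IH; rewrite size_rcons IH. Qed.

Lemma nth_sqrt_seq w n i : (i <= n)%N -> (sqrt_seq w n)`_i = (sqrt_seq w i)`_i.
Proof.
elim: n => [|n IH]; first by rewrite leqn0 => /eqP ->.
rewrite leq_eqVlt => /orP[/eqP -> //|].
by rewrite ltnS => le_in; rewrite /= nth_rcons size_sqrt_seq ltnS le_in IH.
Qed.

Lemma exists_conv_sqrt w : w 0%N = 1 ->
  exists u, u 0%N = 1 /\ conv u u = w.
Proof.
move=> w0; pose u n := (sqrt_seq w n)`_n; exists u; split => //.
apply/funext => -[|n]; first by rewrite conv0E mulr1 w0.
have u0 : u 0%N = 1 by [].
rewrite conv_recl u0 mul1r big_ord_recr /= subnn u0 mulr1.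
have -> : u n.+1 = (w n.+1 - \sum_(i < n) u i.+1 * u (n - i)%N) / 2.
  rewrite {1}/u /= nth_rcons size_sqrt_seq ltnn eqxx; congr ((_ - _) / 2).
  apply: eq_bigr => i _.
  by rewrite !nth_sqrt_seq // leq_subr.
under eq_bigr do rewrite subSS.
by field.
Qed.

End SquareRoot.

(** * Limits and absolutely convergent series of complex numbers *)

Section ComplexLimits.
Variable R : realType.
Implicit Types z s : R[i].

Lemma cabs_ge0 z : 0 <= cabs z.
Proof. by case: z => a b; rewrite sqrtr_ge0. Qed.

Lemma cabsE z : `|z| = ((cabs z)%:C)%C.
Proof. by []. Qed.

Lemma cabsN z : cabs (- z) = cabs z.
Proof. exact: normcN. Qed.

Lemma cabs_eq0 z : (cabs z == 0) = (z == 0).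
Proof.
apply/eqP/eqP => [|->]; first exact: ComplexField.Normc.eq0_normc.
exact: ComplexField.Normc.normc0.
Qed.

Lemma cabs_distC z s : cabs (z - s) = cabs (s - z).
Proof. by rewrite -cabsN opprB. Qed.

Lemma cabs_sum (I : Type) (r : seq I) (P : pred I) (g : I -> R[i]) :
  cabs (\sum_(i <- r | P i) g i) <= \sum_(i <- r | P i) cabs (g i).
Proof.
elim/big_rec2: _ => [|i x y _ le_xy].
  by rewrite ComplexField.Normc.normc0.
by rewrite (le_trans (le_normcD _ _)) // lerD2l.
Qed.

Lemma ler_Re_cabs z : `|complex.Re z| <= cabs z.
Proof.
by case: z => a b /=; rewrite -sqrtr_sqr ler_wsqrtr // lerDl sqr_ge0.
Qed.

Lemma ler_Im_cabs z : `|complex.Im z| <= cabs z.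
Proof.
by case: z => a b /=; rewrite -sqrtr_sqr ler_wsqrtr // lerDr sqr_ge0.
Qed.

Lemma ler_cabs_ReIm z : cabs z <= `|complex.Re z| + `|complex.Im z|.
Proof.
case: z => a b /=; rewrite -ler_sqr ?nnegrE ?sqrtr_ge0 ?addr_ge0 //.
rewrite sqr_sqrtr ?addr_ge0 ?sqr_ge0 // sqrrD !real_normK ?num_real //.
by rewrite addrAC lerDl mulrn_wge0 // mulr_ge0.
Qed.

Definition ccvg (I : Type) (F : set_system I) (u : I -> R[i]) s : Prop :=
  (u : I -> R[i]^o) @ F --> (s : R[i]^o).

Lemma ccvgP (I : Type) (F : set_system I) (FF : Filter F) (u : I -> R[i]) s :
  ccvg F u s <->
  forall e : R, 0 < e -> \forall i \near F, cabs (s - u i) < e.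
Proof.
split=> [/cvgrPdist_lt us e e0|us].
  have := us (e%:C)%C; rewrite ltcR => /(_ e0).
  by apply: filterS => i; rewrite cabsE ltcR.
(* The radius lies in [R[i]], and positivity forces its imaginary part to vanish. *)
apply/cvgrPdist_lt => -[e e'].
rewrite ltcE /= => /andP[/eqP -> e0].
by apply: filterS (us e e0) => i; rewrite cabsE -ltcR.
Qed.

Lemma ccvgM (I : Type) (F : set_system I) (FF : Filter F)
    (u v : I -> R[i]) s t :
  ccvg F u s -> ccvg F v t -> ccvg F (fun i => u i * v i) (s * t).
Proof. by move=> us vt; exact: (@cvgM R[i]^o I F FF u v s t us vt). Qed.

Lemma ccvgD (I : Type) (F : set_system I) (FF : Filter F)
    (u v : I -> R[i]) s t :
  ccvg F u s -> ccvg F v t -> ccvg F (fun i => u i + v i) (s + t).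
Proof. by move=> us vt; exact: (@cvgD R[i]^o R[i]^o I F FF u v s t us vt). Qed.

Lemma ccvgB (I : Type) (F : set_system I) (FF : Filter F)
    (u v : I -> R[i]) s t :
  ccvg F u s -> ccvg F v t -> ccvg F (fun i => u i - v i) (s - t).
Proof. by move=> us vt; exact: (@cvgB R[i]^o R[i]^o I F FF u v s t us vt). Qed.

Lemma ccvg_cst (I : Type) (F : set_system I) (FF : Filter F) s :
  ccvg F (fun=> s) s.
Proof. exact: (@cvg_cst R[i]^o). Qed.

Lemma ccvg_sum (I : Type) (F : set_system I) (FF : Filter F) (J : Type)
    (r : seq J) (u : I -> J -> R[i]) (s : J -> R[i]) :
  (forall j, ccvg F (fun i => u i j) (s j)) ->
  ccvg F (fun i => \sum_(j <- r) u i j) (\sum_(j <- r) s j).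
Proof.
move=> us; elim: r => [|j r IH].
  by under eq_fun do rewrite big_nil; rewrite big_nil; exact: ccvg_cst.
under eq_fun do rewrite big_cons; rewrite big_cons.
exact: ccvgD.
Qed.

Lemma ccvg_unique (I : Type) (F : set_system I) (FF : ProperFilter F)
    (u : I -> R[i]) s t : ccvg F u s -> ccvg F u t -> s = t.
Proof. by move=> us ut; exact: (@cvg_unique R[i]^o _ _ _ _ _ us ut). Qed.

Lemma ccvg_lim (I : Type) (F : set_system I) (FF : ProperFilter F)
    (u : I -> R[i]) s : ccvg F u s -> lim ((u : I -> R[i]^o) @ F) = s.
Proof. by move=> us; exact: (cvg_lim _ us). Qed.

(** Real and imaginary parts are 1-Lipschitz for the modulus, so they inherit the Cauchy condition
    and converge by completeness of [R]. *)
Lemma cauchy_cabs_cvg (I : Type) (F : set_system I) (FF : ProperFilter F)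
    (u : I -> R[i]) :
  (forall e : R, 0 < e -> exists s, \forall i \near F, cabs (s - u i) < e) ->
  exists s, ccvg F u s.
Proof.
move=> cu.
have part (p : R[i] -> R) : {morph p : x y / x - y} ->
    (forall z, `|p z| <= cabs z) -> cvg ((p \o u) @ F).
  move=> pB pz; apply: cauchy_cvg; apply: cauchy_exP => e e0.
  have [s su] := cu e e0; exists (p s); rewrite /fmapE -ball_normE.
  by apply: filterS su => i; apply: le_lt_trans; rewrite /= -pB.
have /cvg_ex[a ua] : cvg ((@complex.Re R \o u) @ F).
  by apply: part; [case=> ? ? [] | exact: ler_Re_cabs].
have /cvg_ex[b ub] : cvg ((@complex.Im R \o u) @ F).
  by apply: part; [case=> ? ? [] | exact: ler_Im_cabs].
exists (a +i* b)%C; apply/ccvgP => e e0.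
have e20 : 0 < e / 2 by rewrite divr_gt0.
move/cvgrPdist_lt: ua => /(_ _ e20) ua; move/cvgrPdist_lt: ub => /(_ _ e20) ub.
apply: filterS2 ua ub => i /= ua ub; rewrite (le_lt_trans (ler_cabs_ReIm _)) //.
rewrite (splitr e); case: (u i) ua ub => x y /= ua ub; exact: ltrD.
Qed.

End ComplexLimits.

(** * Absolutely summable coefficient sequences *)

Section AbsoluteConvergence.
Variable R : realType.
Implicit Types u v w : powser R.

Lemma nneseries_leP (a : nat -> R) m (x : R) : (forall n, 0 <= a n) ->
  (\sum_(m <= n <oo) (a n)%:E <= x%:E)%E <->
  forall N, \sum_(m <= n < N) a n <= x.
Proof.
move=> a0; split=> [ax N|ax].
  rewrite -lee_fin -sumEFin (le_trans _ ax) //.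
  by apply: nneseries_lim_ge => n _ _; rewrite lee_fin.
apply: lime_le; first by apply: is_cvg_nneseries => n _ _; rewrite lee_fin.
by apply: nearW => N; rewrite sumEFin lee_fin.
Qed.

(** A real bound on finite sums replaces the extended-real series of [exists_at1] in all later
    estimates. *)
Definition l1 u := exists M : R, forall N, \sum_(i < N) cabs (u i) <= M.

Lemma exists_at1P u : exists_at1 u <-> l1 u.
Proof.
rewrite /exists_at1; split=> [|[M uM]].
  case E : (\sum_(0 <= n <oo) (cabs (u n))%:E)%E => [x| |] // _; last first.
    have := @nneseries_ge0 R (fun n => (cabs (u n))%:E) xpredT 0%N.
    by rewrite E leeNy_eq => /(_ (fun n _ _ => cabs_ge0 _)).
  exists x => N; rewrite -(big_mkord predT (fun i => cabs (u i))).
  by move: N; apply/(nneseries_leP _ _ (fun n => cabs_ge0 (u n))); rewrite E.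
apply: (@le_lt_trans _ _ M%:E); last exact: ltry.
apply/(nneseries_leP _ _ (fun n => cabs_ge0 (u n))) => N.
by rewrite big_mkord.
Qed.

Lemma sum_cabs_mono u m n : (m <= n)%N ->
  \sum_(i < m) cabs (u i) <= \sum_(i < n) cabs (u i).
Proof.
move=> mn; rewrite -!(big_mkord predT (fun i => cabs (u i))).
rewrite (big_cat_nat (leq0n m) mn) /= lerDl sumr_ge0 // => i _.
exact: cabs_ge0.
Qed.

Lemma l1_shift u m : l1 (fun n => u (n + m)%N) -> l1 u.
Proof.
move=> [M uM]; exists (\sum_(i < m) cabs (u i) + M) => N.
rewrite (le_trans (sum_cabs_mono u (leq_addr m N))) //.
rewrite -!(big_mkord predT (fun i => cabs (u i))).
rewrite (big_cat_nat (leq0n m) (leq_addl N m)) /= lerD2l.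
by rewrite -{1}[m]add0n big_addn addnK big_mkord.
Qed.

Lemma l1_scale a u : l1 u -> l1 (fun n => a * u n).
Proof.
move=> [M uM]; exists (cabs a * M) => N.
under eq_bigr do rewrite ComplexField.Normc.normcM.
by rewrite -mulr_sumr ler_wpM2l ?cabs_ge0.
Qed.

Lemma cabs_conv u v n :
  cabs (conv u v n) <= conv (fun i => cabs (u i)) (fun i => cabs (v i)) n.
Proof.
rewrite (le_trans (cabs_sum _ _ _)) // ler_sum // => i _.
by rewrite ComplexField.Normc.normcM.
Qed.

(** The triangle i + j < N lies inside the square i, j < N. *)
Lemma sum_conv_le (a b : nat -> R) N :
  (forall n, 0 <= a n) -> (forall n, 0 <= b n) ->
  \sum_(n < N) conv a b n <= (\sum_(i < N) a i) * (\sum_(j < N) b j).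
Proof.
move=> a0 b0; rewrite sum_conv mulr_suml ler_sum // => i _.
rewrite ler_wpM2l // -!(big_mkord predT b).
by rewrite (big_cat_nat (leq0n (N - i)) (leq_subr i N)) /= lerDl sumr_ge0.
Qed.

Lemma l1_conv u v : l1 u -> l1 v -> l1 (conv u v).
Proof.
move=> [M uM] [L vL]; exists (M * L) => N.
apply: le_trans (ler_sum _ (fun (i : 'I_N) _ => cabs_conv u v i)) _.
apply: le_trans (sum_conv_le _ (fun n => cabs_ge0 (u n))
  (fun n => cabs_ge0 (v n))) _.
by apply: ler_pM; rewrite ?sumr_ge0 // => i _; exact: cabs_ge0.
Qed.

Lemma nondecreasing_partial_cvg (a : nat -> R) M : (forall n, 0 <= a n) ->
  (forall N, \sum_(i < N) a i <= M) -> cvgn (fun N => \sum_(i < N) a i).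
Proof.
move=> a0 aM; apply: nondecreasing_is_cvgn.
  apply/nondecreasing_seqP => n; by rewrite big_ord_recr lerDl.
by exists M => _ [N _ <-].
Qed.

Lemma cseriesE u N : series (u : nat -> R[i]^o) N = \sum_(i < N) u i :> R[i].
Proof. by rewrite seriesEnat /= big_mkord. Qed.

Lemma cvg_value_at1 u (s : R[i]) :
  ccvg \oo (series (u : nat -> R[i]^o)) s -> value_at1 u = s.
Proof. by move=> us; rewrite /value_at1 (cvg_lim _ us). Qed.

Lemma l1_cvg u : l1 u ->
  ccvg \oo (series (u : nat -> R[i]^o)) (value_at1 u).
Proof.
move=> [M uM].
suff [s us] : exists s, ccvg \oo (series (u : nat -> R[i]^o)) s.
  by rewrite (cvg_value_at1 us).
apply: cauchy_cabs_cvg => e e0.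
have /cvg_ex[l /cvgrPdist_lt/(_ (e / 2))] :=
  nondecreasing_partial_cvg (fun n => cabs_ge0 (u n)) uM.
(* From this [N] on, the partial sums of the moduli are within e/2 of their limit, so any block of
   moduli starting at [N] sums to less than e. *)
rewrite divr_gt0 // => /(_ isT) [N _ lN]; exists (series u N).
exists N => // n /= Nn; rewrite -cabsN opprB !seriesEnat /=.
rewrite (big_cat_nat (leq0n N) Nn) /= addrAC subrr add0r.
apply: le_lt_trans (cabs_sum _ _ _) _.
have -> : \sum_(N <= i < n) cabs (u i) =
   \sum_(i < n) cabs (u i) - \sum_(i < N) cabs (u i).
  rewrite -!(big_mkord predT (fun i => cabs (u i))).
  by rewrite (big_cat_nat (leq0n N) Nn) /= addrAC subrr add0r.
have := lN n Nn; have := lN N (leqnn N) => /=.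
rewrite !ltr_norml => /andP[? ?] /andP[? ?]; lra.
Qed.

Lemma value_at1_conv u v : l1 u -> l1 v ->
  value_at1 (conv u v) = value_at1 u * value_at1 v.
Proof.
move=> lu lv.
have cvgu := l1_cvg lu; have cvgv := l1_cvg lv.
apply: cvg_value_at1.
pose S w N : R[i] := series (w : nat -> R[i]^o) N.
(* The partial sums of the Cauchy product are the products of partial sums minus an error, which is
   shown to tend to 0. *)
have -> : series (conv u v : nat -> R[i]^o) =
    (fun N => S u N * S v N - (S u N * S v N - S (conv u v) N)).
  by apply/funext => N; rewrite /= opprB addrCA subrr addr0.
rewrite -[X in ccvg _ _ X]subr0; apply: ccvgB; first exact: ccvgM cvgu cvgv.
pose a i := cabs (u i); pose b i := cabs (v i).
have a0 i : 0 <= a i by exact: cabs_ge0.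
have b0 i : 0 <= b i by exact: cabs_ge0.
have ab0 i : 0 <= conv a b i by rewrite sumr_ge0 // => j _; rewrite mulr_ge0.
have [M uM] := lu; have [L vL] := lv.
have abML N : \sum_(i < N) conv a b i <= M * L.
  by rewrite (le_trans (sum_conv_le _ a0 b0)) // ler_pM ?sumr_ge0.
have /cvg_ex[l abl] := nondecreasing_partial_cvg ab0 abML.
have abl_le N : \sum_(i < N) conv a b i <= l.
  rewrite -(cvg_lim _ abl) //; apply: nondecreasing_cvgn_le.
    by apply/nondecreasing_seqP => n; rewrite big_ord_recr lerDl.
  by apply/cvg_ex; exists l.
(* The square i, j < N lies inside the triangle i + j < 2N. *)
have prod_le N : (\sum_(i < N) a i) * (\sum_(j < N) b j) <= l.
  rewrite (le_trans _ (abl_le (N + N)%N)) // sum_conv mulr_suml.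
  rewrite big_split_ord /= -[leLHS]addr0 lerD ?sumr_ge0 //; last first.
    by move=> i _; rewrite mulr_ge0 ?sumr_ge0.
  apply: ler_sum => i _; rewrite ler_wpM2l //.
  rewrite -addnBA; last exact: ltnW.
  by rewrite big_split_ord /= lerDl sumr_ge0.
(* The difference of S u N * S v N and S (conv u v) N is dominated by the
   corresponding difference for [a] and [b], hence by the tail of [conv a b]. *)
apply/ccvgP => e e0; move/cvgrPdist_lt: abl => /(_ e e0).
apply: filterS => N; apply: le_lt_trans.
rewrite sub0r cabsN ger0_norm ?subr_ge0 //.
rewrite (le_trans _ (lerB (prod_le N) (lexx _))) //.
rewrite /S !cseriesE !sum_conv !mulr_suml -!sumrB.
apply: le_trans (cabs_sum _ _ _) _; apply: ler_sum => i _.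
rewrite -!mulrBr ComplexField.Normc.normcM ler_wpM2l ?cabs_ge0 //.
rewrite -!(big_mkord predT v) -!(big_mkord predT b).
rewrite !(big_cat_nat (leq0n (N - i)) (leq_subr i N)) /= !(addrAC _ _ (- _)).
by rewrite !subrr !add0r cabs_sum.
Qed.

Lemma value_at1B u v : l1 u -> l1 v ->
  value_at1 (fun n => u n - v n) = value_at1 u - value_at1 v.
Proof.
move=> lu lv; apply: cvg_value_at1.
have -> : series (fun n => u n - v n : R[i]^o) =
    (fun N => series (u : nat -> R[i]^o) N - series (v : nat -> R[i]^o) N).
  by apply/funext => N; rewrite !cseriesE sumrB.
by apply: ccvgB; exact: l1_cvg.
Qed.

(* From [u = 1 + t] and [u^2 = 1 + w], twice the partial sums of [|t|] are at
   most those of [|w|] plus the square of the preceding partial sum of [|t|];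
   so they never exceed 1. *)
Lemma l1_sqrt u w : u 0%N = 1 -> conv u u = w ->
  (forall N, \sum_(i < N) cabs (w i.+1) <= 1) -> l1 u.
Proof.
move=> u0 uuw w1; apply: (@l1_shift _ 1); exists 1 => N.
under eq_bigr do rewrite addn1.
elim: N => [|N IH]; first by rewrite big_ord0 ler01.
pose t n := cabs (u n.+1).
have t0 n : 0 <= t n by exact: cabs_ge0.
have step n : 2 * t n <= cabs (w n.+1) + \sum_(i < n) t i * t (n - i.+1)%N.
  have -> : 2 * t n = cabs (2 * u n.+1).
    rewrite ComplexField.Normc.normcM; congr (_ * _).
    by rewrite -[2]/(1 *+ 2) normcMn ComplexField.Normc.normc1.
  have -> : 2 * u n.+1 = w n.+1 - \sum_(i < n) u i.+1 * u (n - i)%N.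
    rewrite -uuw conv_recl u0 mul1r big_ord_recr /= subnn u0 mulr1.
    by under [in RHS]eq_bigr do rewrite subSS; ring.
  apply: le_trans (le_normcD _ _) _; rewrite cabsN lerD2l.
  apply: le_trans (cabs_sum _ _ _) _; apply: ler_sum => i _.
  by rewrite ComplexField.Normc.normcM /t -subSn // subSS.
suff : 2 * \sum_(i < N.+1) t i <= 2 by rewrite -/(t _); lra.
rewrite mulr_sumr (le_trans (ler_sum _ (fun (i : 'I_N.+1) _ => step i))) //.
rewrite big_split /=.
have := w1 N.+1.
suff : \sum_(i < N.+1) \sum_(j < i) t j * t (i - j.+1)%N <= 1 by lra.
rewrite big_ord_recl big_ord0 add0r.
have := @sum_conv_le t t N t0 t0.
have : (\sum_(i < N) t i) * (\sum_(i < N) t i) <= 1 * 1.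
  by apply: ler_pM; rewrite ?sumr_ge0.
rewrite mulr1 => h1 h2; apply: le_trans (le_trans h2 h1).
by apply: ler_sum => i _; rewrite lift0 /conv; under eq_bigr do rewrite subSS.
Qed.

(** Solving v u = w for the newest coefficient of u shows that each partial sum U of moduli
    satisfies U <= M + c U, whence U <= M / (1 - c). *)
Lemma l1_div u v w (c : R) : v 0%N = 1 -> c < 1 ->
  (forall N, \sum_(i < N) cabs (v i.+1) <= c) ->
  conv v u = w -> l1 w -> l1 u.
Proof.
move=> v0 c1 vc vuw [M wM]; exists (M / (1 - c)) => N.
have c10 : 0 < 1 - c by rewrite subr_gt0.
rewrite ler_pdivlMr // mulrBr mulr1 lerBlDr.
have M0 : 0 <= M by have := wM 0%N; rewrite big_ord0.
have c0 : 0 <= c by have := vc 0%N; rewrite big_ord0.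
case: N => [|N]; first by rewrite big_ord0 mul0r addr0.
have step n : cabs (u n) <=
    cabs (w n) + \sum_(i < n) cabs (v i.+1) * cabs (u (n - i.+1)%N).
  have -> : u n = w n - \sum_(i < n) v i.+1 * u (n - i.+1)%N.
    by rewrite -vuw conv_recl v0 mul1r addrK.
  apply: le_trans (le_normcD _ _) _; rewrite cabsN lerD2l.
  apply: le_trans (cabs_sum _ _ _) _; apply: ler_sum => i _.
  by rewrite ComplexField.Normc.normcM.
rewrite (le_trans (ler_sum _ (fun (i : 'I_N.+1) _ => step i))) //.
rewrite big_split lerD ?wM //=.
rewrite big_ord_recl big_ord0 add0r.
pose a i := cabs (v i.+1); pose b i := cabs (u i).
have a0 n : 0 <= a n by exact: cabs_ge0.
have b0 n : 0 <= b n by exact: cabs_ge0.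
apply: (@le_trans _ _ (\sum_(i < N) conv a b i)).
  by apply: ler_sum => i _; rewrite lift0 /conv; under eq_bigr do rewrite subSS.
apply: le_trans (sum_conv_le _ a0 b0) _; rewrite mulrC.
apply: ler_pM; rewrite ?sumr_ge0 //; exact: sum_cabs_mono.
Qed.

(** Every nonempty partial sum is 1 + t with t of modulus at most c, so it stays at distance at
    least 1 - c from 0. *)
Lemma value_at1_neq0 u (c : R) : u 0%N = 1 -> c < 1 ->
  (forall N, \sum_(i < N) cabs (u i.+1) <= c) -> value_at1 u != 0.
Proof.
move=> u0 c1 uc.
have lu : l1 u.
  by apply: (@l1_shift _ 1); exists c => N; under eq_bigr do rewrite addn1.
apply/eqP => s0; have /ccvgP/(_ (1 - c)) := l1_cvg lu.
rewrite subr_gt0 s0 => /(_ c1) [N _ /(_ N.+1 (leqnSn N))].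
rewrite /= sub0r cabsN cseriesE big_ord_recl u0.
set t := \sum_(i < N) _.
have : cabs t <= c.
  by apply: le_trans (cabs_sum _ _ _) _; rewrite (le_trans _ (uc N)).
have := le_normcD (1 + t) (- t).
rewrite addrK cabsN ComplexField.Normc.normc1; lra.
Qed.

End AbsoluteConvergence.

(** * Unordered sums *)

Lemma big_uniq_sub (V : nmodType) (T : eqType) (r0 r : seq T) (F : T -> V) :
  uniq r0 -> uniq r -> {subset r0 <= r} ->
  \sum_(x <- r) F x = \sum_(x <- r0) F x + \sum_(x <- r | x \notin r0) F x.
Proof.
move=> ur0 ur r0r; rewrite (bigID (mem r0)) /=; congr (_ + _).
rewrite -big_filter; apply: perm_big; apply: uniq_perm => //.
  exact: filter_uniq.
move=> x; rewrite mem_filter; case: (boolP (x \in r0)) => //= xr0.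
by rewrite r0r.
Qed.

#[local] Existing Instance summability.totally_filter.

Section UnorderedSums.
Variable R : realType.

Lemma abs_summableS (T : choiceType) (X Y : set T) (g : T -> R[i]) :
  X `<=` Y -> abs_summable Y g -> abs_summable X g.
Proof.
move=> XY; apply: le_lt_trans.
rewrite esum_mkcond [leRHS]esum_mkcond; apply: le_esum => x _.
case: ifPn => [/set_mem/XY/mem_set -> //|_].
by case: ifPn => _; rewrite ?abse_ge0.
Qed.

Lemma abs_summable_bij (T T' : choiceType) (X : set T) (Y : set T')
    (e : T -> T') (g : T' -> R[i]) :
  set_bij X Y e -> abs_summable X (g \o e) -> abs_summable Y g.
Proof.
by move=> eXY; rewrite /abs_summable /summable (reindex_esum _ _ _ _ eXY).
Qed.

Section AbsolutelySummable.
Variables (T : choiceType) (X : set T) (g : T -> R[i]).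
Hypothesis gX : abs_summable X g.
Let G x := if x \in X then g x else 0.

(** Summability makes the extended-real sum finite; [s] is its real value, the supremum of the
    finite sums of moduli. *)
Lemma abs_summable_sup : exists s : R,
  (forall r : seq T, uniq r -> \sum_(x <- r) cabs (G x) <= s) /\
  forall e : R, 0 < e -> exists2 r : {fset T}, true &
     s - e < \sum_(x <- r) cabs (G x).
Proof.
pose S := (\esum_(x in [set: T]) (cabs (G x))%:E)%E.
have SE : S = (\esum_(x in X) `|(cabs (g x))%:E|)%E.
  rewrite esum_mkcond; apply: eq_esum => x _; rewrite /G.
  case: ifP => _; last by rewrite ComplexField.Normc.normc0.
  by rewrite gee0_abs // lee_fin cabs_ge0.
have Sfin : S \is a fin_num.
  by rewrite SE -summableE; exact: gX.
exists (fine S); split=> [r ur|e e0].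
  rewrite -lee_fin fineK // -sumEFin; apply: esum_ge.
  exists [set` seq_fset tt r]; first by split; [exact: finite_fset|].
  rewrite fsbig_finite /=; last exact: finite_fset.
  have rE : perm_eq (seq_fset tt r) r.
    by apply: uniq_perm => // x; rewrite seq_fsetE.
  by rewrite set_fsetK (perm_big _ rE).
have [_ [A [finA _] <-] SA] := ub_ereal_sup_adherent e0 Sfin.
exists (fset_set A) => //.
have : (S - e%:E < \sum_(x \in A) (cabs (G x))%:E)%E := SA.
by rewrite -(fineK Sfin) fsbig_finite // sumEFin -EFinB lte_fin.
Qed.

(** The terms outside [r0] have total modulus at most what [r0] leaves of the bound [s]. *)
Lemma cabs_sum_subset (s : R) (r0 r : seq T) :
  (forall r : seq T, uniq r -> \sum_(x <- r) cabs (G x) <= s) ->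
  uniq r0 -> uniq r -> {subset r0 <= r} ->
  cabs (\sum_(x <- r0) G x - \sum_(x <- r) G x) <=
    s - \sum_(x <- r0) cabs (G x).
Proof.
move=> sup ur0 ur r0r; rewrite lerBrDl (le_trans _ (sup r ur)) //.
rewrite [leRHS](big_uniq_sub _ ur0) // lerD2l.
rewrite (@big_uniq_sub _ _ r0 r) // opprD addrA subrr sub0r cabsN.
exact: cabs_sum.
Qed.

Lemma partial_sumE (A : {fset T}) :
  summability.partial_sum G A = \sum_(x <- A) G x.
Proof. by rewrite big_seq_fsetE. Qed.

Lemma csum_ccvg :
  ccvg summability.totally (summability.partial_sum G) (csum X g).
Proof.
have [s [sup adh]] := abs_summable_sup.
suff [t tG] : exists t, ccvg summability.totally (summability.partial_sum G) t.
  by rewrite (_ : csum X g = t) //; exact: ccvg_lim tG.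
apply: cauchy_cabs_cvg => e e0; have [r0 _ r0s] := adh e e0.
exists (\sum_(x <- r0) G x); exists r0 => // r /= /fsubsetP r0r.
rewrite partial_sumE; apply: le_lt_trans (cabs_sum_subset sup _ _ r0r) _ => //.
by rewrite ltrBlDr addrC -ltrBlDr.
Qed.

(** This turns the limit over all finite sets into a limit of a sequence, along any exhaustion of
    [X] by finite lists. *)
Lemma csum_ccvg_seq (J : nat -> seq T) :
  (forall N, uniq (J N)) ->
  (forall x, X x -> \forall N \near \oo, x \in J N) ->
  ccvg \oo (fun N => \sum_(x <- J N | x \in X) g x) (csum X g).
Proof.
move=> uJ exh; have /ccvgP cG := csum_ccvg.
apply/ccvgP => e e0; have [r0 _ r0e] := cG e e0.
pose r1 := [fset x in r0 | x \in X]%fset.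
have sub (r : seq T) : (forall x, x \in r -> \forall N \near \oo, x \in J N) ->
    \forall N \near \oo, {subset r <= J N}.
  elim: r => [|x r IH] xr; first by exists 0%N => // N _ y; rewrite in_nil.
  have /filterS2 := xr x (mem_head x r); apply.
    2: by apply: IH => y yr; apply: xr; rewrite inE yr orbT.
  by move=> N xN rN y; rewrite inE => /predU1P[-> //|/rN].
have : \forall N \near \oo, {subset (r1 : seq T) <= J N}.
  by apply: sub => x; rewrite !inE => /andP[_ /set_mem]; exact: exh.
apply: filterS => N r1N.
(* Enlarging [J N] by [r0] makes the estimate applicable without changing the sum: the added points
   lie outside [X], because [J N] already contains [r1]. *)
pose r := (r0 `|` seq_fset tt (J N))%fset.
have := r0e r (fsubsetUl _ _); rewrite /= partial_sumE.
suff -> : \sum_(x <- r) G x = \sum_(x <- J N | x \in X) g x by [].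
rewrite (@big_uniq_sub _ _ (J N)) ?fset_uniq //; last first.
  by move=> x xJ; rewrite inE seq_fsetE xJ orbT.
rewrite -[RHS]addr0 [in RHS]big_mkcond; congr (_ + _).
rewrite big_seq_cond big1 // => x; rewrite inE seq_fsetE => /andP[xr xJ].
rewrite (negbTE xJ) orbF in xr; rewrite /G; case: ifPn => // xX.
by move: xJ; rewrite r1N // !inE xr.
Qed.

End AbsolutelySummable.

Lemma csum_bij (T : countType) (T' : choiceType) (X : set T) (Y : set T')
    (e : T -> T') (g : T' -> R[i]) :
  set_bij X Y e -> abs_summable Y g -> csum Y g = csum X (g \o e).
Proof.
move=> eXY gY; have [eX einj esurj] := eXY.
have gX : abs_summable X (g \o e).
  by move: gY; rewrite /abs_summable /summable (reindex_esum _ _ _ _ eXY).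
(* Decoding the first [N] integers exhausts the countable type [T]; the images under [e] then
   exhaust [Y], so both sums are limits of the same sequence. *)
pose J N := pmap (@pickle_inv T) (iota 0 N).
have uJ N : uniq (J N).
  by apply: pmap_uniq (iota_uniq _ _); exact: pickle_invK.
have exhJ x : \forall N \near \oo, x \in J N.
  exists (choice.pickle x).+1 => // N /= xN; rewrite mem_pmap; apply/mapP.
  by exists (choice.pickle x); rewrite ?pickleK_inv // mem_iota.
have cX := csum_ccvg_seq gX uJ (fun x _ => exhJ x).
pose J' N := map e [seq x <- J N | x \in X].
apply: ccvg_unique cX.
suff -> : (fun N => \sum_(x <- J N | x \in X) (g \o e) x) =
          (fun N => \sum_(y <- J' N | y \in Y) g y).
  apply: (csum_ccvg_seq gY) => [N|y].
    rewrite map_inj_in_uniq ?filter_uniq // => x x'.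
    rewrite !mem_filter => /andP[xX _] /andP[x'X _]; exact: einj.
  move=> /esurj[x Xx <-]; apply: filterS (exhJ x) => N xN.
  by apply: map_f; rewrite mem_filter xN mem_set.
apply/funext => N; rewrite /J' big_map big_filter_cond.
by apply: eq_bigl => x; case: (boolP (x \in X)) => //= /set_mem/eX/mem_set ->.
Qed.

End UnorderedSums.

(** * Sums over walks *)

Section Walks.
Variables (R : realType) (h : weight R).

Lemma edge_weight_diag a : edge_weight h a a = 0.
Proof.
rewrite /edge_weight insubF //; apply/negbTE.
by rewrite fsetUid cardfs1.
Qed.

Lemma edge_weightC a b : edge_weight h a b = edge_weight h b a.
Proof. by rewrite /edge_weight fsetUC. Qed.

Lemma walk_weight1 a : walk_weight h [:: a] = 1.
Proof. by rewrite /walk_weight big_geq. Qed.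

Lemma walk_weight_cons a b s :
  walk_weight h [:: a, b & s] = edge_weight h a b * walk_weight h (b :: s).
Proof.
rewrite /walk_weight /= big_nat_recl // big_add1 /=; congr (_ * _).
by rewrite [RHS]big_add1.
Qed.

(** The dummy value 0 on the diagonal kills tuples with equal neighbours, so finite sums may range
    over all tuples. *)
Lemma walk_weight_nonwalk a s :
  ~~ is_walk (a :: s) -> walk_weight h (a :: s) = 0.
Proof.
elim: s a => // b s IH a; rewrite /is_walk /= walk_weight_cons negb_and negbK.
by case/orP => [/eqP ->|/IH ->]; rewrite ?edge_weight_diag ?mul0r ?mulr0.
Qed.

Lemma walk_weight_rev w : walk_weight h (rev w) = walk_weight h w.
Proof.
rewrite /walk_weight size_rev big_nat_rev /=.
apply: eq_big_nat => i /andP[i0 iw].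
rewrite !nth_rev; try lia.
by rewrite edge_weightC; congr (edge_weight h (nth _ _ _) (nth _ _ _)); lia.
Qed.

Lemma is_walk_rev w : is_walk (rev w) = is_walk w.
Proof.
rewrite /is_walk size_rev rev_sorted; congr (_ && _).
by apply: eq_sorted => a b /=; rewrite eq_sym.
Qed.

Lemma is_walk_map (f : vertex -> vertex) w :
  injective f -> is_walk (map f w) = is_walk w.
Proof.
move=> finj; rewrite /is_walk size_map sorted_map; congr (_ && _).
by apply: eq_sorted => a b /=; rewrite (inj_eq finj).
Qed.

Lemma walk_weight_map (f : vertex -> vertex) w :
  (forall a b, a != b -> edge_weight h (f a) (f b) = edge_weight h a b) ->
  walk_weight h (map f w) = walk_weight h w.
Proof.
move=> fh; have fh' a b : edge_weight h (f a) (f b) = edge_weight h a b.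
  by have [->|/fh //] := eqVneq a b; rewrite !edge_weight_diag.
case: w => // a s; elim: s a => [|b s IH] a; first by rewrite !walk_weight1.
by rewrite /= !walk_weight_cons fh' -IH.
Qed.

Definition walks_from (a : vertex) (n : nat) (P : pred (seq vertex)) :
  set (seq vertex) :=
  [set w | [/\ is_walk w, size w = n.+1, head vertex1 w = a & P w]].

Lemma walks_from_sub a n P : walks_from a n P `<=` walks_from a n predT.
Proof. by move=> w []. Qed.

(** * Truncated sums over walks and the first-visit decomposition *)

Definition vertices N : seq vertex := pmap insub (iota 0 N).

Lemma mem_vertices N (a : vertex) : (a \in vertices N) = (val a < N)%N.
Proof. by rewrite mem_pmap_sub mem_iota. Qed.

Fixpoint tails N n : seq (seq vertex) :=
  if n is n'.+1 then [seq a :: s | a <- vertices N, s <- tails N n']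
  else [:: [::]].

Lemma tails_uniq N n : uniq (tails N n).
Proof.
elim: n => //= n IH; apply: allpairs_uniq => //.
  by apply: pmap_sub_uniq; exact: iota_uniq.
by move=> [a s] [b t] _ _ [-> ->].
Qed.

Lemma mem_tails N n s :
  (s \in tails N n) = (size s == n) && all (fun a => val a < N)%N s.
Proof.
elim: n s => [|n IH] [|a s] //=.
  by apply/negbTE/allpairsP => -[[b t] []].
rewrite eqSS andbCA -IH -mem_vertices.
apply/allpairsP/andP => [[[b t] /= [bN tN [-> ->]]] //|[aN sN]].
by exists (a, s).
Qed.

(* Identities between sums over infinitely many walks are proved for the walks
   whose vertices after the first are smaller than [N], which are finitely many,
   and then [N] tends to infinity. *)
Definition tsum N n a (P : pred (seq vertex)) : R[i] :=
  \sum_(s <- tails N n | P (a :: s)) walk_weight h (a :: s).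

Lemma tsum0 N a P : tsum N 0 a P = (P [:: a])%:R.
Proof. by rewrite /tsum /= big_mkcond big_seq1 walk_weight1; case: (P _). Qed.

Lemma tsumS N n a P : tsum N n.+1 a P =
  \sum_(b <- vertices N) edge_weight h a b * tsum N n b (fun w => P (a :: w)).
Proof.
rewrite /tsum /= big_mkcond /= big_allpairs_dep /=; apply: eq_bigr => b _.
rewrite -big_mkcond /= mulr_sumr; apply: eq_bigr => s _.
by rewrite walk_weight_cons.
Qed.

Lemma eq_tsum N n a P Q : (forall s, P (a :: s) = Q (a :: s)) ->
  tsum N n a P = tsum N n a Q.
Proof. by move=> PQ; apply: eq_bigl => s; rewrite PQ. Qed.

Lemma tsum_pred0 N n a P : (forall s, P (a :: s) = false) -> tsum N n a P = 0.
Proof. by move=> P0; rewrite /tsum big_pred0. Qed.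

(** [index] gives the first occurrence, and the full size when [v] is absent; hence [v] occurs
    exactly once, as the last entry. *)
Definition stops_at (v : vertex) (w : seq vertex) : bool :=
  (index v w).+1 == size w.

(** Here [i] is the time of the first visit of [v]. The induction strips the first vertex; [p] looks
    only at the endpoint, which the remainder of the walk keeps. *)
Lemma tsum_first_visit N n (v a : vertex) (p : pred vertex) :
  tsum N n a (fun w => (v \in w) && p (last vertex1 w)) =
  \sum_(i < n.+1) tsum N i a (stops_at v) *
                  tsum N (n - i) v (fun w => p (last vertex1 w)).
Proof.
elim: n a => [|n IH] a; have [->|av] := eqVneq a v.
- rewrite big_ord_recl big_ord0 addr0 !tsum0 /stops_at /= inE !eqxx mul1r.
  by [].
- rewrite big_ord_recl big_ord0 addr0 !tsum0 /stops_at /= inE (negbTE av).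
  by rewrite eq_sym (negbTE av) mul0r.
(* Starting at [v], the first visit is at time 0, so only i = 0 contributes. *)
- rewrite big_ord_recl big1 => [|i _]; last first.
    rewrite lift0 tsumS mulr_suml big1 // => b _.
    by rewrite tsum_pred0 ?mulr0 ?mul0r // => s; rewrite /stops_at /= eqxx.
  rewrite addr0 subn0 tsum0 /stops_at /= eqxx mul1r; apply: eq_tsum => s.
  by rewrite mem_head.
(* Starting elsewhere, the term i = 0 vanishes, and the first edge factors out of all the others. *)
have sa : stops_at v [:: a] = false by rewrite /stops_at /= (negbTE av).
rewrite big_ord_recl tsum0 sa mul0r add0r tsumS.
under [RHS]eq_bigr => i _ do rewrite lift0 subSS tsumS mulr_suml.
rewrite exchange_big /=; apply: eq_bigr => b _.
under [RHS]eq_bigr => i _ do rewrite -mulrA.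
rewrite -mulr_sumr; congr (_ * _).
transitivity (tsum N n b (fun w => (v \in w) && p (last vertex1 w))).
  by apply: eq_tsum => s; rewrite [v \in a :: _]inE eq_sym (negbTE av).
rewrite IH; apply: eq_bigr => i _; congr (_ * _).
by apply: eq_tsum => s; rewrite /stops_at /= (negbTE av).
Qed.

Lemma tsumID N n a (Q P : pred (seq vertex)) :
  tsum N n a P =
  tsum N n a (fun w => Q w && P w) + tsum N n a (fun w => ~~ Q w && P w).
Proof.
by rewrite /tsum (bigID (fun s => Q (a :: s))) /=; congr (_ + _);
  apply: eq_bigl => s; rewrite andbC.
Qed.

Definition wsum a n (P : pred (seq vertex)) : R[i] :=
  set_weight h (walks_from a n P).

Lemma tsum_ccvg a n P : abs_summable (walks_from a n predT) (walk_weight h) ->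
  ccvg \oo (fun N => tsum N n a P) (wsum a n P).
Proof.
move=> /(abs_summableS (@walks_from_sub a n P)) hP.
pose J N := map (cons a) (tails N n).
suff -> : (fun N => tsum N n a P) =
    (fun N => \sum_(w <- J N | w \in walks_from a n P) walk_weight h w).
  apply: (csum_ccvg_seq hP) => [N|w [_ + + _]].
    by rewrite map_inj_uniq ?tails_uniq // => s t [].
  case: w => // b s [sn] /= ->.
  (* A walk has finitely many vertices, so it appears once [N] exceeds all of them. *)
  exists (\max_(b <- s) (val b).+1)%N => // N /= maxN.
  rewrite map_f // mem_tails sn eqxx; apply/allP => c cs.
  by apply: leq_trans maxN; rewrite (big_rem c) //= leq_maxl.
apply/funext => N; rewrite /tsum /J big_map big_mkcond [RHS]big_mkcond.
apply: eq_big_seq => s; rewrite mem_tails => /andP[/eqP sn _].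
case: ifPn => [Pas|nPas]; case: ifPn => //; last first.
  by move=> /set_mem[_ _ _]; rewrite (negbTE nPas).
move=> /negP ninw; apply: walk_weight_nonwalk; apply/negP => was.
by apply: ninw; apply/mem_set; split => //=; rewrite sn.
Qed.

(** For fixed length the sum over [i] is finite, so the truncated identity passes to the limit term
    by term. *)
Lemma wsum_first_visit n (v a : vertex) (p : pred vertex) :
  (forall m, abs_summable (walks_from a m predT) (walk_weight h)) ->
  (forall m, abs_summable (walks_from v m predT) (walk_weight h)) ->
  wsum a n (fun w => (v \in w) && p (last vertex1 w)) =
  \sum_(i < n.+1) wsum a i (stops_at v) *
                  wsum v (n - i) (fun w => p (last vertex1 w)).
Proof.
move=> ha hv; apply: (ccvg_unique _ (tsum_ccvg (ha n))).
under eq_fun do rewrite tsum_first_visit.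
by apply: ccvg_sum => i; apply: ccvgM; exact: tsum_ccvg.
Qed.

Lemma wsumID a n (Q P : pred (seq vertex)) :
  abs_summable (walks_from a n predT) (walk_weight h) ->
  wsum a n P =
  wsum a n (fun w => Q w && P w) + wsum a n (fun w => ~~ Q w && P w).
Proof.
move=> ha; apply: (ccvg_unique _ (tsum_ccvg ha)).
under eq_fun do rewrite (tsumID _ _ _ Q).
by apply: ccvgD; exact: tsum_ccvg.
Qed.

Lemma eq_wsum a n (P Q : pred (seq vertex)) :
  (forall w, size w = n.+1 -> P w = Q w) -> wsum a n P = wsum a n Q.
Proof.
move=> PQ; rewrite /wsum; congr set_weight; apply/seteqP.
by split=> w [ww wn wa]; split; rewrite // ?PQ // -PQ.
Qed.

Lemma wsum0 a P : abs_summable (walks_from a 0 predT) (walk_weight h) ->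
  wsum a 0 P = (P [:: a])%:R.
Proof.
move=> ha; apply: (ccvg_unique _ (tsum_ccvg ha)).
by under eq_fun do rewrite tsum0; exact: ccvg_cst.
Qed.

Lemma set_bij_rev a b n :
  set_bij (walks_from b n (fun w => last vertex1 w == a))
          (walks_from a n (fun w => last vertex1 w == b)) rev.
Proof.
have rev_in c d w : walks_from c n (fun w => last vertex1 w == d) w ->
    walks_from d n (fun w => last vertex1 w == c) (rev w).
  case: w => [|x w]; first by case.
  move=> [ww wn /= <- /eqP wd]; split; rewrite ?is_walk_rev ?size_rev //.
    case/lastP: w wd {ww wn} => [|w y]; first by move=> /= ->.
    by rewrite last_rcons => <-; rewrite -rcons_cons rev_rcons.
  by rewrite rev_cons last_rcons.
split; first by move=> w /rev_in.
  by move=> w w' _ _; exact: (can_inj revK).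
by move=> w /rev_in ww; exists (rev w); rewrite ?revK.
Qed.

Lemma wsum_rev a b n :
  abs_summable (walks_from a n predT) (walk_weight h) ->
  wsum a n (fun w => last vertex1 w == b) =
  wsum b n (fun w => last vertex1 w == a).
Proof.
move=> ha; rewrite /wsum /set_weight (csum_bij (set_bij_rev a b n)).
  by congr csum; apply/funext => w /=; rewrite walk_weight_rev.
exact: abs_summableS (@walks_from_sub _ _ _) ha.
Qed.

(** * Transport of walk sums along an automorphism of the weight *)

Section Automorphism.
Variables (f : vertex -> vertex).
Hypothesis f_bij : bijective f.
Hypothesis f_weight : forall a b, a != b ->
  edge_weight h (f a) (f b) = edge_weight h a b.

Lemma set_bij_map a n P : set_bij (walks_from a n (fun w => P (map f w)))
  (walks_from (f a) n P) (map f).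
Proof.
have [g gf fg] := f_bij; have finj := bij_inj f_bij; split.
- move=> [|x w] [// ww wn wa Pw]; split; rewrite ?is_walk_map ?size_map //.
  by rewrite /= -wa.
- by move=> w w' _ _; exact: inj_map.
- move=> w [ww wn wa Pw]; have wE : map f (map g w) = w by exact: mapK.
  exists (map g w) => //; rewrite -wE in ww wn wa Pw.
  rewrite is_walk_map // in ww; rewrite size_map in wn; split => //.
  by case: (map g w) wn wa => //= y s _ /finj.
Qed.

Lemma abs_summable_automorphism a n P :
  abs_summable (walks_from a n (fun w => P (map f w))) (walk_weight h) ->
  abs_summable (walks_from (f a) n P) (walk_weight h).
Proof.
move=> ha; apply: (abs_summable_bij (set_bij_map a n P)).
rewrite (_ : _ \o _ = walk_weight h) //.
by apply/funext => w /=; rewrite walk_weight_map.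
Qed.

Lemma wsum_automorphism a n P :
  abs_summable (walks_from a n predT) (walk_weight h) ->
  wsum (f a) n P = wsum a n (fun w => P (map f w)).
Proof.
move=> ha; rewrite /wsum /set_weight (csum_bij (set_bij_map a n P)).
  by congr csum; apply/funext => w /=; rewrite walk_weight_map.
apply: abs_summable_automorphism.
exact: abs_summableS (@walks_from_sub _ _ _) ha.
Qed.

End Automorphism.
End Walks.

(** * First-passage equations for A and B *)

Section FirstPassage.
Variables (R : realType) (h : weight R) (v : vertex).
Hypothesis h_light : light h.
Hypothesis h_trans : v_transitive v h.

Definition first_passage : powser R := fun n => wsum h vertex1 n (stops_at v).
Local Notation H := first_passage.

Lemma light_walks_from n :
  abs_summable (walks_from vertex1 n predT) (walk_weight h).
Proof. by apply: abs_summableS (h_light n) => w []. Qed.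

Lemma light_walks_from_v n :
  abs_summable (walks_from v n predT) (walk_weight h).
Proof.
have [f [f_bij <- fh]] := h_trans.
by apply: (abs_summable_automorphism f_bij fh); exact: light_walks_from.
Qed.

Lemma D_serE n : D_ser h n = wsum h v n predT.
Proof.
have [f [f_bij <- fh]] := h_trans.
rewrite (wsum_automorphism f_bij fh); last exact: light_walks_from.
by congr set_weight; apply/seteqP; split=> w [].
Qed.

Lemma B_serE n :
  B_ser h n = wsum h vertex1 n (fun w => last vertex1 w == vertex1).
Proof.
congr set_weight; apply/seteqP; split=> w.
  by move=> [[ww wn w1] /eqP].
by move=> [ww wn w1 /eqP].
Qed.

Lemma B_serE_v n : B_ser h n = wsum h v n (fun w => last vertex1 w == v).
Proof.
have [f [f_bij <- fh]] := h_trans.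
rewrite (wsum_automorphism f_bij fh); last exact: light_walks_from.
rewrite B_serE; apply: eq_wsum => -[|a s] //= _.
by rewrite last_map (inj_eq (bij_inj f_bij)).
Qed.

Lemma B_ser0 : B_ser h 0 = 1.
Proof. by rewrite B_serE wsum0 //; exact: light_walks_from. Qed.

Lemma A_ser_conv : A_ser h v = conv H (D_ser h).
Proof.
apply/funext => n.
transitivity (wsum h vertex1 n (fun w => (v \in w) && predT (last vertex1 w))).
  congr set_weight; apply/seteqP; split=> w.
    by move=> [[ww wn w1] vw]; split; rewrite ?andbT.
  by move=> [ww wn w1]; rewrite andbT.
rewrite wsum_first_visit; first last.
- exact: light_walks_from_v.
- exact: light_walks_from.
by apply: eq_bigr => i _; rewrite D_serE.
Qed.

Lemma B_ser_conv :
  B_ser h = (fun n => Bv_ser h v n + conv H (conv H (B_ser h)) n).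
Proof.
(* A walk from [v] to 1, once reversed, ends at [v] and hence visits it; after the first visit it is
   a closed walk at [v], and those are counted by B. *)
have G n : wsum h v n (fun w => last vertex1 w == vertex1) = conv H (B_ser h) n.
  rewrite wsum_rev; last exact: light_walks_from_v.
  transitivity (wsum h vertex1 n (fun w => (v \in w) && (last vertex1 w == v))).
    apply: eq_wsum => -[|a s] //= _; case: eqP; rewrite ?andbF // => <-.
    by rewrite mem_last.
  rewrite (wsum_first_visit _ (pred1 v)); first last.
  - exact: light_walks_from_v.
  - exact: light_walks_from.
  by apply: eq_bigr => i _; rewrite B_serE_v.
apply/funext => n; rewrite {1}B_serE (wsumID (fun w => v \in w)); last first.
  exact: light_walks_from.
rewrite addrC; congr (_ + _).
  congr set_weight; apply/seteqP; split=> w.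
    by move=> [ww wn w1 /andP[vw /eqP wl]].
  by move=> [[[ww wn w1] wl] vw]; split; rewrite // vw wl eqxx.
rewrite (wsum_first_visit _ (pred1 vertex1)); first last.
- exact: light_walks_from_v.
- exact: light_walks_from.
by apply: eq_bigr => i _; rewrite -G.
Qed.

End FirstPassage.

(** * Absolute convergence of the first-passage series *)

Section PowerSeries.
Variable R : realType.
Implicit Types u v w B E : powser R.

Lemma lowest_term u : (exists n, u n != 0) ->
  exists2 m, u m != 0 & forall i, (i < m)%N -> u i = 0.
Proof.
move=> ex; exists (ex_minn ex); case: ex_minnP => // m _ min i im.
by apply/eqP; apply/negPn/negP => /min; rewrite leqNgt im.
Qed.

(** As B has constant term 1, the lowest term of u^2 B is that of u^2. *)
Lemma conv_conv_lowest u B m : (forall i, (i < m)%N -> u i = 0) -> B 0%N = 1 ->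
  conv u (conv u B) (m + m)%N = u m ^+ 2.
Proof.
move=> u0 B0; rewrite -[X in (X + m)%N]add0n conv_shift2 // !conv0E B0 mulr1.
by rewrite !add0n.
Qed.

Lemma conv_conv_eq0 u B : B 0%N = 1 ->
  (forall n, conv u (conv u B) n = 0) -> forall n, u n = 0.
Proof.
move=> B0 uuB n; apply/eqP; apply/negPn/negP => un.
have [m um u0] := lowest_term (ex_intro _ n un).
have := uuB (m + m)%N; rewrite conv_conv_lowest // => /eqP.
by rewrite sqrf_eq0 (negbTE um).
Qed.

Lemma l1_of_conv_conv u B E (c : R) k : B 0%N = 1 -> c < 1 ->
  (forall N, \sum_(i < N) cabs (B i.+1) <= c) ->
  conv u (conv u B) = E -> E k != 0 -> (forall j, (j < k)%N -> E j = 0) ->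
  (forall N, \sum_(i < N) cabs (E (k + i.+1)%N) <= cabs (E k) * (1 - c)) ->
  l1 u.
Proof.
move=> B0 c1 Bc uuB Ek E0 Ec.
have c0 : 0 <= c by have := Bc 0%N; rewrite big_ord0.
have exu : exists n, u n != 0.
  apply/not_existsP => u0; case/eqP: Ek; rewrite -uuB.
  apply: (@conv_lt _ k.+1) => // i _; apply/eqP; apply/negPn/negP; exact: u0.
have [m um u0] := lowest_term exu.
have Emm : E (m + m)%N = u m ^+ 2 by rewrite -uuB conv_conv_lowest.
(* Both numbers are the order of u^2 B = E. *)
have kE : k = (m + m)%N.
  case: (ltngtP k (m + m)%N) => // [km|/E0 Em0].
    by move: Ek; rewrite -uuB (conv2_lt B u0 km) eqxx.
  by move: um; rewrite -sqrf_eq0 -Emm Em0 eqxx.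
(* Both series are divided by their lowest terms, which gives s^2 B = e with constant terms 1. *)
pose s n := (u m)^-1 * u (n + m)%N.
pose e n := (E k)^-1 * E (n + k)%N.
have ssB : conv s (conv s B) = e.
  apply/funext => n; rewrite convZl convC.
  have -> : conv s B = (fun n => (u m)^-1 * conv (fun i => u (i + m)%N) B n).
    by apply/funext => i; rewrite convZl.
  rewrite convZl convC -conv_shift2 // uuB /e kE Emm addnA mulrA.
  by rewrite expr2 invfM.
have s0 : s 0%N = 1 by rewrite /s add0n mulVf.
(* With q^2 = B one has (s q)^2 = e, so the square-root estimate applies to both q and s q. *)
have [q [q0 qq]] := exists_conv_sqrt B0.
have lq : l1 q.
  by apply: (l1_sqrt q0 qq) => N; rewrite (le_trans (Bc N)) // ltW.
have lsq : l1 (conv s q).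
  apply: (@l1_sqrt _ _ e); first by rewrite conv0E s0 q0 mulr1.
    rewrite -ssB -qq -convA; congr conv; rewrite convA [conv q s]convC.
    by rewrite convA.
  (* Dividing [Ec] by the modulus of [E k] bounds the tail of [e] by 1 - c, which is at most 1 since
     c is nonnegative. *)
  move=> N; under eq_bigr do rewrite ComplexField.Normc.normcM addnC.
  rewrite -mulr_sumr ComplexField.Normc.normcV.
  have Ek0 : 0 < cabs (E k) by rewrite lt_neqAle cabs_ge0 eq_sym cabs_eq0 Ek.
  rewrite ler_pdivrMl // mulr1 (le_trans (Ec N)) // ler_piMr ?cabs_ge0 //.
  by rewrite lerBlDr lerDl.
have ls : l1 s.
  apply: (l1_div B0 c1 Bc _ (l1_conv lsq lq)).
  by rewrite -convA qq convC.
apply: (@l1_shift _ _ m).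
have -> : (fun n => u (n + m)%N) = (fun n => u m * s n).
  by apply/funext => n; rewrite /s mulrA divff ?mul1r.
exact: l1_scale.
Qed.

End PowerSeries.

Theorem theorem8 (R : realType) (v : vertex) (h : weight R) (c : R) :
  v <> vertex1 ->
  light h ->
  v_transitive v h ->
  reachable h v ->
  exists_at1 (D_ser h) ->
  exists_at1 (Bv_ser h v) ->
  (\sum_(1 <= n <oo) (cabs (B_ser h n))%:E = c%:E)%E ->
  c < 1 ->
  (Bv_ser h v = B_ser h -> A_ser h v = (fun=> 0)) /\
  (Bv_ser h v <> B_ser h ->
   forall k : nat,
     Bv_ser h v k <> B_ser h k ->
     (forall j : nat, (j < k)%N -> Bv_ser h v j = B_ser h j) ->
     (((cabs (Bv_ser h v k - B_ser h k) * (1 - c))^-1)%:E *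
       \sum_(k.+1 <= n <oo) (cabs (Bv_ser h v n - B_ser h n))%:E < 1)%E ->
     [/\ exists_at1 (B_ser h),
         value_at1 (B_ser h) <> 0,
         exists_at1 (A_ser h v)
       & mul_sqrt (value_at1 (D_ser h))
           (1 - value_at1 (Bv_ser h v) / value_at1 (B_ser h))
           (value_at1 (A_ser h v))]).
Proof.
move=> _ h_light h_trans _ /exists_at1P lD /exists_at1P lBv Bsum c1.
pose H := first_passage h v.
have AE : A_ser h v = conv H (D_ser h) := A_ser_conv h_light h_trans.
have B0 : B_ser h 0 = 1 := B_ser0 h_light.
have HHB : conv H (conv H (B_ser h)) = (fun n => B_ser h n - Bv_ser h v n).
  apply/funext => n.
  by rewrite {2}(B_ser_conv h_light h_trans) addrAC subrr add0r.
split=> [BvB|_ k Ek E0 Ec].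
  (* Now H^2 B = 0, while a nonzero H would give this product a nonzero lowest term. *)
  have H0 n : H n = 0 by apply: (conv_conv_eq0 B0) => i; rewrite HHB BvB subrr.
  by apply/funext => n; rewrite AE; apply: big1 => i _; rewrite H0 mul0r.
have Bc N : \sum_(i < N) cabs (B_ser h i.+1) <= c.
  have := Bsum; move=> /eqP; rewrite eq_le => /andP[+ _].
  move=> /nneseries_leP/(_ N.+1).
  rewrite big_add1 big_mkord; apply => n; exact: cabs_ge0.
have lB : l1 (B_ser h).
  by apply: (@l1_shift _ _ 1); exists c => N; under eq_bigr do rewrite addn1.
have B1 := value_at1_neq0 B0 c1 Bc.
have lH : l1 H.
  apply: (l1_of_conv_conv B0 c1 Bc HHB (k := k)).
  - by rewrite subr_eq0 eq_sym; apply/eqP.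
  - by move=> j /E0 ->; rewrite subrr.
  move=> N; set x := cabs _ * _.
  have x0 : 0 < x.
    rewrite mulr_gt0 ?subr_gt0 // lt_neqAle cabs_ge0 eq_sym cabs_eq0 subr_eq0.
    by rewrite eq_sym andbT; apply/eqP.
  (* Clearing the denominator of the hypothesis gives the tail bound in the form required for H. *)
  have : (\sum_(k.+1 <= n <oo) (cabs (Bv_ser h v n - B_ser h n))%:E <= x%:E)%E.
    move: Ec; rewrite cabs_distC -/x -[X in (_ < X)%E]/(1%:E) => /ltW.
    by rewrite muleC lee_pdivrMr // mul1e.
  move=> /nneseries_leP/(_ (N + k.+1)%N).
  rewrite -{1}[k.+1]add0n big_addn addnK big_mkord.
  move=> /(_ (fun=> cabs_ge0 _)); apply: le_trans.
  by apply: ler_sum => i _; rewrite cabs_distC -addSnnS addnC.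
split; [exact/exists_at1P | exact/eqP | | ].
  by apply/exists_at1P; rewrite AE; exact: l1_conv.
(* The required square root is H(1): evaluate H^2 B = B - B_v at 1 and divide by B(1). *)
exists (value_at1 H); last by rewrite AE value_at1_conv // mulrC.
have : value_at1 H * (value_at1 H * value_at1 (B_ser h)) =
    value_at1 (B_ser h) - value_at1 (Bv_ser h v).
  by rewrite -value_at1B // -HHB !value_at1_conv //; exact: l1_conv.
move=> /(congr1 (fun x => x / value_at1 (B_ser h))).
by rewrite /= mulrBl divff // mulrA mulfK // expr2.
Qed.
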